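(* Let $\alpha\in[0,1]$ and let $b_1,b_2,\ldots$ and $c_1,c_2,\ldots$ be the (finite or infinite) sequences produced by Shulga's algorithm applied to $\alpha$. Then for every $n\ge1$, whenever the terms involved are defined, $$b_{n+1}\ge b_n,\qquad b_{n+2}\ge b_n+1,\qquad b_n\ge n.$$
   Context: Continued fractions: $[a_0;a_1,a_2,\ldots]=a_0+\cfrac{1}{a_1+\cfrac{1}{a_2+\cdots}}$ with $a_0\in\mathbb{Z}$ and positive integers $a_i$ ($i\ge1$). For rational numbers one uses the finite expansion whose last partial quotient is greater than $1$, except that for the number $1$ one uses $1=[0;1]$, i.e. $a_1(1)=1$. $a_n(x)$ denotes the $n$th partial quotient of $x$ (undefined if $n$ exceeds the length of the expansion). An empty list of partial quotients gives $[0;\,]=0$. Shulga's algorithm for $\alpha\in[0,1]$: for $n=0,1,2,\ldots$, suppose $b_k,c_k$ are defined for $1\le k\le n$. If $\alpha=[0;b_1,\ldots,b_n]+[0;c_1,\ldots,c_n]$, put $\beta=[0;b_1,\ldots,b_n]$, $\gamma=[0;c_1,\ldots,c_n]$ and stop. Otherwise define $$b_{n+1}=a_{n+1}(\alpha-[0;c_1,\ldots,c_n])+1,\qquad c_{n+1}=a_{n+1}(\alpha-[0;b_1,\ldots,b_n,b_{n+1}]).$$ If the algorithm never stops, put $\beta=[0;b_1,b_2,\ldots]$, $\gamma=[0;c_1,c_2,\ldots]$. It is known (Shulga) that these quantities are always well defined and that $\alpha=\beta+\gamma$; this is called the Shulga decomposition of $\alpha$. *)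

(* Defs.v *)
From HB Require Import structures.
From mathcomp Require Import all_boot all_order all_algebra.
From mathcomp Require Import all_classical all_reals all_analysis.

Set Implicit Arguments.
Unset Strict Implicit.
Unset Printing Implicit Defensive.

Import Order.TTheory GRing.Theory Num.Theory.
Import numFieldNormedType.Exports.

Local Open Scope classical_set_scope.
Local Open Scope ring_scope.

Section ContinuedFractions.
Variable R : realType.
Implicit Types (x : R) (s : seq int).

(* [0; s_0, s_1, ...]; the leading 0 is implicit, so that cfrac [::] = 0. *)
Fixpoint cfrac s : R :=
  if s is a :: s' then (a%:~R + cfrac s')^-1 else 0.

(* x = [a0; s], with the last entry of s greater than 1, except 1 = [0; 1].
   The condition on the last entry concerns positive indices only: an integer
   m <> 1 has the expansion [m; ]. *)
Definition finite_cf x (a0 : int) s : Prop :=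
  [/\ all (fun a => 0 < a) s,
      x = a0%:~R + cfrac s &
      if x == 1 then (a0 == 0) && (s == [:: 1])
      else (s == [::]) || (1 < last 0 s)].

Definition infinite_cf x (a : nat -> int) : Prop :=
  (forall i, (0 < i)%N -> 0 < a i) /\
  (fun n : nat => (a 0%N)%:~R + cfrac (mkseq (fun i => a i.+1) n)) @ \oo --> x.

Definition is_partial_quotient (n : nat) x (k : int) : Prop :=
  (exists a0 s, [/\ finite_cf x a0 s, (n <= size s)%N & k = nth 0 (a0 :: s) n])
  \/ (exists2 a, infinite_cf x a & k = a n).

(* a_n(x), or None if n exceeds the length of the expansion of x. *)
Definition partial_quotient (n : nat) x : option int :=
  xget None [set Some k | k in is_partial_quotient n x].

End ContinuedFractions.

Section ShulgaAlgorithm.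
Variables (R : realType) (alpha : R).
Implicit Types (bs cs : seq int) (n : nat).

(* b_{n+1}, given bs = [b_1, ..., b_n] and cs = [c_1, ..., c_n];
   None if the algorithm stops at step n. *)
Definition next_b bs cs : option int :=
  if alpha == cfrac R bs + cfrac R cs then None
  else omap (fun a => a + 1)
         (partial_quotient (size bs).+1 (alpha - cfrac R cs)).

(* c_{n+1}, given bs = [b_1, ..., b_n] and b = b_{n+1} *)
Definition next_c bs (b : int) : option int :=
  partial_quotient (size bs).+1 (alpha - cfrac R (rcons bs b)).

(* ([b_1, ..., b_n], [c_1, ..., c_n]), if all these terms are defined *)
Fixpoint shulga_prefix n : option (seq int * seq int) :=
  if n is n'.+1 then
    obind (fun p : seq int * seq int =>
      obind (fun b =>
        omap (fun c => (rcons p.1 b, rcons p.2 c)) (next_c p.1 b))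
      (next_b p.1 p.2))
    (shulga_prefix n')
  else Some ([::], [::]).

(* The sequence b_1, b_2, ...; indices start at 1. *)
Definition shulga_b n : option int :=
  if n is n'.+1 then obind (fun p => next_b p.1 p.2) (shulga_prefix n')
  else None.

End ShulgaAlgorithm.

(* Main.v *)
Require Import Defs.
From HB Require Import structures.
From mathcomp Require Import all_boot all_order all_algebra.
From mathcomp Require Import all_classical all_reals all_analysis.
From mathcomp Require Import ring lra zify.

Set Implicit Arguments.
Unset Strict Implicit.
Unset Printing Implicit Defensive.

Import Order.TTheory GRing.Theory Num.Theory.
Import numFieldNormedType.Exports.

Local Open Scope ring_scope.

(** The algorithm is an orbit of a rational map on three real numbers, and the
    growth of the digits is a property of that map alone.

    After n steps write
      alpha = [0; b_1, ..., b_n] + [0; c_1, ..., c_n + t]      with 0 <= t < 1,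
      alpha - [0; c_1, ..., c_n] = [0; b_1, ..., b_n + 1/U],
    so that b_(n+1) = b = floor U + 1, and let e = b - U in (0, 1] be the amount
    by which the next digit overshoots.  If y denotes the inverse of the
    overshoot of the previous step (y = 0 at the start), then the next values
    c = c_(n+1), t', y', U' satisfy
      e t (c + t') = b + y,     e t' U' = c - 1/t,     y' = 1/e,
    in which no continued fraction is left.  The link between the two pictures
    is a pair of identities between the denominators of the convergents of both
    expansions (balanced), which one step of the algorithm preserves
    (balanced_step); shulga_tracks then carries it along the whole algorithm.

    Eliminating c gives e^2 t t' U' = b + y - e (1 + t t'), from which:
    - U' > b - 1, so the next digit is at least b (quo_step_gt);
    - if e <= 1/2, the division by e^2 makes the next digit at least b + 2
      (digb_step_jump).
    If b is repeated, then c >= b + 1, because c is an integer and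
    c + t' >= b + y; this forces e' <= 1/(b + 1), in particular e' <= 1/2
    (gap_step_repeat).  So a repetition is always followed by a jump by 2,
    which gives b_(n+2) >= b_n + 1.  For b_n >= n the induction
    maintains that b_n >= n + 1, or that b_n >= n and the overshoot is at most
    1/2, so that a jump is due (ahead).

    All this needs y >= 1, which fails at the very first step only.  There
    c_1 >= b_1 (b_1 - 1) replaces it: the first digit can be repeated only when
    b_1 = b_2 = 2 (start_repeat), and then the orbit has one free parameter
    left.  That family contains the one stretch without margin: after 2, 2 the
    digit 3 can follow, with an overshoot that may exceed 1/2, and then
    U >= 7/2 at the fourth digit puts the sequence ahead again
    (start_repeat_quo). *)

(** * Partial quotients and the Gauss map *)

Definition gauss (R : realType) (x : R) : R := x^-1 - (Num.floor x^-1)%:~R.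

Notation positive s := (all (fun a : int => 0 < a) s).

Lemma floor_add (R : realType) (a : int) (x : R) :
  0 <= x < 1 -> Num.floor (a%:~R + x) = a.
Proof.
by case/andP=> x0 x1; apply: floor_def; rewrite intrD1 lerDl x0 ltrD2l.
Qed.

Lemma gauss_inv (R : realType) (a : int) (x : R) :
  0 <= x < 1 -> gauss (a%:~R + x)^-1 = x.
Proof. by move=> x01; rewrite /gauss invrK floor_add // addrC addKr. Qed.

Lemma digit_ge1 (R : realType) (a : int) : 0 < a -> 1 <= a%:~R :> R.
Proof. by move=> a0; rewrite -[1]/(1%:~R) ler_int. Qed.

Lemma cfrac_itv (R : realType) (s : seq int) :
  positive s -> 0 <= cfrac R s <= 1.
Proof.
elim: s => [|a s IH] /=; first by rewrite lexx ler01.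
case/andP=> /(digit_ge1 R) a1 /IH /andP[s0 s1].
by rewrite invr_ge0 invf_le1; [apply/andP; split; lra|lra].
Qed.

(** The condition on the last entry keeps every complete quotient above 1, so
    that the Gauss map strips exactly one entry of s. *)
Lemma finite_cf_digit (R : realType) (s : seq int) (n : nat) :
  positive s -> (s == [::]) || (1 < last 0 s) ->
  0 <= cfrac R s < 1 /\
  ((n < size s)%N -> nth 0 s n = Num.floor (iter n (@gauss R) (cfrac R s))^-1).
Proof.
elim: s n => [|a s IH] n /=; first by rewrite lexx ltr01.
case/andP=> a0 ps lst.
have lst' : (s == [::]) || (1 < last 0 s) by case: (s) lst.
have /andP[s0 s1] := (IH 0%N ps lst').1.
have a1 := digit_ge1 R a0.
have gt1 : 1 < a%:~R + cfrac R s.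
  case: (s) lst ps s0 s1 => [|c s'] /= lst ps s0 s1.
    by rewrite addr0 -[1]/(1%:~R) ltr_int.
  case/andP: ps => /(digit_ge1 R) c1 /(cfrac_itv R)/andP[r0 r1].
  have : 0 < (c%:~R + cfrac R s')^-1 by rewrite invr_gt0; lra.
  lra.
split; first by rewrite invr_ge0 invf_lt1; [apply/andP; split; lra|lra].
case: n => [|n] ns; first by rewrite /= invrK floor_add // s0.
by rewrite iterSr gauss_inv ?s0 //; apply: (IH n ps lst').2.
Qed.

Lemma mkseqS_head (T : Type) (a : nat -> T) (n : nat) :
  mkseq a n.+1 = a 0%N :: mkseq (a \o S) n.
Proof. by rewrite /mkseq /= (iotaDl 1 0) -map_comp. Qed.

Section InfiniteExpansions.
Local Open Scope classical_set_scope.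

(** Every value with first entry a_0 is at least 1/(a_0 + 1), which keeps the
    limit away from 0 and lets the inversion pass to the limit. *)
Lemma infinite_cf_tail (R : realType) (a : nat -> int) (x : R) :
  (forall i, 0 < a i) -> (fun n => cfrac R (mkseq a n)) @ \oo --> x ->
  0 < x /\ exists y : R, x = ((a 0%N)%:~R + y)^-1 /\
    (fun n => cfrac R (mkseq (a \o S) n)) @ \oo --> y.
Proof.
move=> pa cx; set A := (a 0%N)%:~R : R.
have A1 : 1 <= A by exact: digit_ge1.
have pm : forall n, positive (mkseq (a \o S) n).
  by move=> n; apply/allP => _ /mapP[i _ ->]; exact: pa.
have cx' : (fun n => (A + cfrac R (mkseq (a \o S) n))^-1) @ \oo --> x.
  move: cx; rewrite -cvg_shiftS; apply: cvg_trans; apply: near_eq_cvg.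
  by near=> n; rewrite -[LHS]/(cfrac R (mkseq a n.+1)) mkseqS_head.
have x0 : 0 < x.
  apply: (@lt_le_trans _ _ (A + 1)^-1); first by rewrite invr_gt0; lra.
  rewrite -(cvg_lim _ cx') //; apply: limr_ge; first by apply/cvg_ex; exists x.
  near=> n; have /andP[c0 c1] := cfrac_itv R (pm n).
  by rewrite lef_pV2 ?posrE; lra.
split => //; exists (x^-1 - A); split; first by rewrite addrC subrK invrK.
apply: (cvg_trans _ (cvgB (cvgV (lt0r_neq0 x0) cx') (cvg_cst A))).
apply: near_eq_cvg; near=> n.
rewrite -[LHS]/((A + cfrac R (mkseq (a \o S) n))^-1^-1 - A).
by rewrite invrK addrC addKr.
Unshelve. all: by end_near. Qed.

(** A limit x is 1/(a_0 + y) with y > 0 again a limit of the same kind, hence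
    x < 1: the Gauss map acts on x as the shift of digits. *)
Lemma infinite_cf_digit (R : realType) (a : nat -> int) (x : R) (n : nat) :
  (forall i, 0 < a i) -> (fun n => cfrac R (mkseq a n)) @ \oo --> x ->
  0 < x < 1 /\ a n = Num.floor (iter n (@gauss R) x)^-1.
Proof.
have itv b z : (forall i, 0 < b i) ->
    (fun n => cfrac R (mkseq b n)) @ \oo --> z -> 0 < z < 1.
  move=> pb cz; have [z0 [y [-> cy]]] := infinite_cf_tail pb cz.
  have [y0 _] := infinite_cf_tail (fun i => pb i.+1) cy.
  have b1 := digit_ge1 R (pb 0%N).
  by rewrite invr_gt0 invf_lt1; [apply/andP; split; lra|lra].
elim: n a x => [|n IH] a x pa cx; split; try exact: itv cx;
  have [_ [y [-> cy]]] := infinite_cf_tail pa cx;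
  have /andP[y0 y1] := itv _ _ (fun i => pa i.+1) cy.
  by rewrite /= invrK floor_add // ltW.
rewrite iterSr gauss_inv ?(ltW y0) //.
exact: (IH (a \o S) y (fun i => pa i.+1) cy).2.
Qed.

End InfiniteExpansions.

(** The expansion 1 = [0; 1] does not start with the integer part of 1, but it
    has a single digit after the 0, and this digit is floor 1. *)
Lemma partial_quotient_floor (R : realType) (n : nat) (x : R) (k : int) :
  0 < x <= 1 -> partial_quotient n.+1 x = Some k ->
  k = Num.floor (iter n (@gauss R) x)^-1.
Proof.
move=> /andP[x0 x1]; rewrite /partial_quotient.
case: xgetP => [y _ [j hj <-] [<-]|//].
case: hj => [[a0 [s [[ps xE lst] ns ->]]]|[a [pa ca] ->]] /=.
  have [x1'|xn1] := eqVneq x 1.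
    rewrite x1' eqxx in lst; case/andP: lst => _ /eqP sE.
    by move: ns; rewrite sE x1'; case: n => //= _; rewrite invr1 floor1.
  rewrite (negPf xn1) in lst.
  have [c01 h] := finite_cf_digit R n ps lst.
  rewrite h //; congr (Num.floor (iter _ _ _)^-1).
  have := floor_add a0 c01; rewrite -xE xE.
  have -> : Num.floor (a0%:~R + cfrac R s) = 0.
    by rewrite -xE; apply: floor_def; rewrite ltW //= lt_neqAle xn1.
  by move=> <-; rewrite add0r.
set z := x - (a 0%N)%:~R.
have cz : ((fun n => cfrac R (mkseq (a \o S) n)) @ \oo --> z)%classic.
  apply: (cvg_trans _ (cvgB ca (cvg_cst ((a 0%N)%:~R : R)))).
  apply: near_eq_cvg; near=> m; set A := (a 0%N)%:~R.
  by rewrite -[LHS]/(A + cfrac R (mkseq (a \o S) m) - A) addrC addKr.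
have [z01 h] := infinite_cf_digit n (fun i => pa i.+1 isT) cz.
rewrite [a n.+1]h; congr (Num.floor (iter _ _ _)^-1).
have : a 0%N = 0.
  case/andP: z01 => z0 z1; rewrite /z in z0 z1.
  have h1 : (a 0%N)%:~R < 1%:~R :> R by apply: lt_le_trans x1; lra.
  have h2 : (- 1)%:~R < (a 0%N)%:~R :> R by rewrite rmorphN /=; lra.
  by move: h1 h2; rewrite !ltr_int; lia.
by rewrite /z => ->; rewrite subr0.
Unshelve. all: by end_near. Qed.

(** * Continued fractions with a real tail *)

(** [0; s_0, ..., s_k + u] with a real number u added to the last entry; the
    empty list gives u. *)
Fixpoint cftail (R : realType) (s : seq int) (u : R) : R :=
  if s is a :: s' then (a%:~R + cftail s' u)^-1 else u.

Lemma cfrac_cftail (R : realType) (s : seq int) : cfrac R s = cftail s 0.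
Proof. by elim: s => //= a s ->. Qed.

Lemma cftail_rcons (R : realType) (s : seq int) (a : int) (u : R) :
  cftail (rcons s a) u = cftail s (a%:~R + u)^-1.
Proof. by elim: s => //= b s ->. Qed.

Lemma cftail_itv (R : realType) (s : seq int) (u : R) :
  positive s -> 0 < u < 1 -> 0 < cftail s u < 1.
Proof.
move=> + u01; elim: s => //= a s IH /andP[/(digit_ge1 R) a1 /IH /andP[s0 s1]].
by rewrite invr_gt0 invf_lt1; [apply/andP; split; lra|lra].
Qed.

Lemma iter_gauss_cftail (R : realType) (s : seq int) (u : R) :
  positive s -> 0 < u < 1 -> iter (size s) (@gauss R) (cftail s u) = u.
Proof.
move=> + u01; elim: s => // a s IH /andP[_ ps].
have /andP[s0 s1] := cftail_itv ps u01.
by rewrite [size _]/= iterSr gauss_inv ?(ltW s0) //; exact: IH.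
Qed.

(** The first digit of alpha = 1 is the case of s empty and u = 1. *)
Lemma partial_quotient_cftail (R : realType) (s : seq int) (u : R) (k : int) :
  positive s -> 0 < u <= 1 -> s = [::] \/ u < 1 ->
  partial_quotient (size s).+1 (cftail s u) = Some k -> k = Num.floor u^-1.
Proof.
move=> ps /andP[u0 u1] [s0|ult1].
  rewrite s0; apply: (@partial_quotient_floor _ 0 u); exact/andP.
have u01 : 0 < u < 1 by apply/andP.
have /andP[s0 s1] := cftail_itv ps u01.
rewrite -[u in Num.floor u^-1](iter_gauss_cftail ps u01).
by apply: partial_quotient_floor; rewrite s0 ltW.
Qed.

(** The denominators of the last two convergents of [0; s_0, s_1, ...]. *)
Definition conts (R : realType) (s : seq int) : R * R :=
  foldl (fun d a => (d.1 * a%:~R + d.2, d.1)) (1, 0) s.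

Lemma conts_rcons (R : realType) (s : seq int) (a : int) :
  conts R (rcons s a) = ((conts R s).1 * a%:~R + (conts R s).2, (conts R s).1).
Proof. by rewrite /conts foldl_rcons. Qed.

Lemma conts_gt0 (R : realType) (s : seq int) :
  positive s -> 0 < (conts R s).1 /\ 0 <= (conts R s).2.
Proof.
elim/last_ind: s => [|s a IH]; first by rewrite /= ltr01 lexx.
rewrite all_rcons conts_rcons => /andP[/(digit_ge1 R) a1 /IH [q0 q0']] /=.
by split; [rewrite ltr_wpDr // mulr_gt0 //; lra|exact: ltW].
Qed.

Lemma cftail_sub (R : realType) (s : seq int) (u v : R) :
  positive s -> 0 <= u -> 0 <= v ->
  cftail s u - cftail s v = (-1) ^+ size s * (u - v) /
    (((conts R s).1 + u * (conts R s).2) * ((conts R s).1 + v * (conts R s).2)).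
Proof.
elim/last_ind: s u v => [|s a IH] u v.
  by move=> _ _ _; rewrite /= !mulr0 !addr0 expr0 mul1r mulr1 invr1 mulr1.
rewrite all_rcons => /andP[/(digit_ge1 R) a1 ps] u0 v0.
rewrite !cftail_rcons size_rcons conts_rcons [in RHS]/=.
have [q0 q0'] := conts_gt0 R ps.
have au : 0 < a%:~R + u by lra.
have av : 0 < a%:~R + v by lra.
rewrite IH //; try by rewrite invr_ge0 ltW.
have hq w : 0 < a%:~R + w ->
    0 < (conts R s).1 * (a%:~R + w) + (conts R s).2.
  by move=> h; rewrite ltr_wpDr // mulr_gt0.
have := hq _ au; have := hq _ av; move: q0 q0' au av.
set q := (conts R s).1; set q' := (conts R s).2; set A := a%:~R.
move=> q0 q0' au av hv hu; rewrite exprS.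
field.
have hu' : q * A + q' + u * q = q * (A + u) + q' by ring.
have hv' : q * A + q' + v * q = q * (A + v) + q' by ring.
rewrite hu' hv' !gt_eqF //.
Qed.

(** * The step map *)

(** After n steps: rem is t in alpha - [0; b_1, ..., b_n] =
    [0; c_1, ..., c_n + t], quo is U in alpha - [0; c_1, ..., c_n] =
    [0; b_1, ..., b_n + 1/U], and igap is the inverse of b_n - U for the value
    of U one step earlier, 0 at the start. *)
Record state (R : realType) := State { rem : R; igap : R; quo : R }.

Definition digb (R : realType) (z : state R) : int := Num.floor (quo z) + 1.
Definition gap (R : realType) (z : state R) : R := (digb z)%:~R - quo z.

(** The complete quotient whose integer part is the next digit c: with
    b = digb z,
      alpha - [0; b_1, ..., b_n, b] = [0; c_1, ..., c_n + 1/cquo z]. *)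
Definition cquo (R : realType) (z : state R) : R :=
  ((digb z)%:~R + igap z) / (gap z * rem z).
Definition digc (R : realType) (z : state R) : int := Num.floor (cquo z).

Definition step (R : realType) (z : state R) : state R :=
  let t := cquo z - (digc z)%:~R in
  State t (gap z)^-1 (((digc z)%:~R - (rem z)^-1) / (gap z * t)).

Definition start (R : realType) (alpha : R) := State alpha 0 alpha^-1.

Lemma gap_itv (R : realType) (z : state R) : 0 < gap z <= 1.
Proof.
rewrite /gap /digb; have /andP[] := floor_itv (quo z).
by rewrite intrD1 => h1 h2; apply/andP; split; lra.
Qed.

Lemma lt_digb (R : realType) (z : state R) (m : int) :
  (m < digb z) = (m%:~R <= quo z).
Proof. by rewrite /digb ltzD1 floor_ge_int. Qed.

Lemma intr_le_add (R : realType) (m n : int) (t : R) :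
  t < 1 -> m%:~R <= n%:~R + t -> m%:~R <= n%:~R :> R.
Proof.
move=> t1 h; rewrite ler_int -ltzD1 -(ltr_int R) intrD1.
by apply: le_lt_trans h _; rewrite ltrD2l.
Qed.

Lemma rem_step_itv (R : realType) (z : state R) : 0 <= rem (step z) < 1.
Proof.
rewrite /= /digc; have /andP[] := floor_itv (cquo z).
by rewrite intrD1 => h1 h2; apply/andP; split; lra.
Qed.

Lemma rem_step_gt0 (R : realType) (z : state R) :
  rem (step z) != 0 -> 0 < rem (step z) < 1.
Proof.
move=> n0; have /andP[h ->] := rem_step_itv z.
by rewrite andbT lt_neqAle eq_sym n0.
Qed.

Lemma igap_step (R : realType) (z : state R) : 1 <= igap (step z).
Proof. by have /andP[e0 e1] := gap_itv z; rewrite /= invf_ge1. Qed.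

Lemma step_c (R : realType) (z : state R) : rem z != 0 ->
  gap z * rem z * ((digc z)%:~R + rem (step z)) = (digb z)%:~R + igap z.
Proof.
move=> t0; have /andP[e0 _] := gap_itv z.
by rewrite /= addrC subrK /cquo; field; rewrite t0 gt_eqF.
Qed.

Lemma step_b (R : realType) (z : state R) : rem (step z) != 0 ->
  gap z * rem (step z) * quo (step z) = (digc z)%:~R - (rem z)^-1.
Proof.
have /andP[e0 _] := gap_itv z.
rewrite /=; set t := cquo z - _ => t0.
by rewrite mulrC divfK // mulf_neq0 // gt_eqF.
Qed.

(** Eliminating the digit c from step_c and step_b leaves only quantities with
    bounds known in advance. *)
Lemma quo_step (R : realType) (z : state R) :
  rem z != 0 -> rem (step z) != 0 ->
  gap z ^+ 2 * (rem z * rem (step z)) * quo (step z)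
  = (digb z)%:~R + igap z - gap z * (1 + rem z * rem (step z)).
Proof.
move=> t0 t0'; have hc := step_c t0; have hb := step_b t0'.
have -> : gap z ^+ 2 * (rem z * rem (step z)) * quo (step z)
  = gap z * rem z * (gap z * rem (step z) * quo (step z)) by ring.
rewrite hb -hc; by field.
Qed.

Lemma digb_ge2 (R : realType) (z : state R) :
  1 <= quo z -> 2 <= (digb z)%:~R :> R.
Proof.
move=> U1; have : 1 < digb z by rewrite lt_digb.
by rewrite -lez1D -(ler_int R) rmorphD.
Qed.

(** These are the bounds that hold from the first step on; at the start igap
    is 0 and rem may be 1. *)
Definition regular (R : realType) (z : state R) :=
  [/\ 0 < rem z < 1, 1 <= igap z & 1 < quo z].

(** In quo_step the left side at U' = b - 1 is at most w (b - 1), where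
    w = t t' < 1, while the right side is at least b - w, as e <= 1 <= y. *)
Lemma quo_step_gt (R : realType) (z : state R) :
  regular z -> rem (step z) != 0 -> (digb z)%:~R - 1 < quo (step z).
Proof.
case=> /andP[t0 t1] y1 U1 tn0'; have /andP[t0' t1'] := rem_step_gt0 tn0'.
have hq := quo_step (lt0r_neq0 t0) tn0'.
have /andP[e0 e1] := gap_itv z.
have hw0 : 0 < rem z * rem (step z) by rewrite mulr_gt0.
have hw1 : rem z * rem (step z) < 1 by nra.
have b1 : 1 < (digb z)%:~R :> R by move: e0; rewrite /gap; lra.
move: hq hw0 hw1; set w := rem z * _; set e := gap z in e0 e1 *.
set b := (digb z)%:~R in b1 *; set U := quo _ => hq hw0 hw1.
have ew : 0 < e ^+ 2 * w by rewrite mulr_gt0 // exprn_gt0.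
rewrite -(ltr_pM2l ew) hq.
have e21 : e ^+ 2 <= 1 by nra.
have h1 : e ^+ 2 * w * (b - 1) <= w * (b - 1).
  rewrite -mulrA ler_piMl //; nra.
have h2 : w * b < b by nra.
nra.
Qed.

Lemma regular_step (R : realType) (z : state R) :
  regular z -> rem (step z) != 0 -> regular (step z).
Proof.
move=> rz t0; have [_ _ U1] := rz; split; first exact: rem_step_gt0.
  exact: igap_step.
apply: le_lt_trans (quo_step_gt rz t0).
by have := digb_ge2 (ltW U1); lra.
Qed.

Lemma le_digb (R : realType) (z : state R) (m : int) :
  m%:~R - 1 <= quo z -> m <= digb z.
Proof.
move=> h; rewrite -ltzD1 -ltrBlDr lt_digb.
by rewrite rmorphB.
Qed.

Lemma digb_step (R : realType) (z : state R) :
  regular z -> rem (step z) != 0 -> digb z <= digb (step z).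
Proof. by move=> rz t0; exact/le_digb/ltW/quo_step_gt. Qed.

(** Since e t (c + t') = b + y with e t <= 1 and y >= 1, the integer c is at
    least b + 1.  If U' = b - e' is still below b, eliminating 1/t between the
    two step relations yields e' (b + 1) <= 1. *)
Lemma gap_step_repeat (R : realType) (z : state R) :
  regular z -> rem (step z) != 0 -> digb (step z) = digb z ->
  gap (step z) <= 1 / 2.
Proof.
case=> /andP[t0 t1] y1 U1 tn0' bb; have /andP[t0' t1'] := rem_step_gt0 tn0'.
have hc := step_c (lt0r_neq0 t0); have hb := step_b tn0'.
have /andP[e0 e1] := gap_itv z; have /andP[e0' e1'] := gap_itv (step z).
have : quo (step z) = (digb z)%:~R - gap (step z) by rewrite /gap bb; ring.
have b2 : 2 <= (digb z)%:~R :> R by exact/digb_ge2/ltW.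
have B0 : 0 < (digb z)%:~R + 1 :> R by lra.
move: hc hb => + + hU; rewrite hU.
set B := (digb z)%:~R in b2 B0 *; set t' := rem (step z) in t0' t1' *.
set e' := gap (step z) in e0' e1' *; set e := gap z in e0 e1 *.
set t := rem z in t0 t1 *; set y := igap z in y1 *.
move=> hc hb.
have cB : B + 1 <= (digc z)%:~R.
  have et0 : 0 < e * t by rewrite mulr_gt0.
  have c0 : 0 < (digc z)%:~R + t' by rewrite -(pmulr_rgt0 _ et0) hc; lra.
  have et1 : e * t <= 1 by nra.
  have : B + y <= (digc z)%:~R + t' by rewrite -hc ler_piMl // ltW.
  have -> : B + 1 = (digb z + 1)%:~R by rewrite rmorphD.
  by move=> h; apply: (intr_le_add t1'); rewrite rmorphD /= -/B; lra.
set c := (digc z)%:~R in hc hb cB.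
have ti : (B + y) * t^-1 = e * (c + t').
  by rewrite -hc; field; rewrite gt_eqF.
have ti0 : 0 < t^-1 by rewrite invr_gt0.
have h1 : (B + 1) * t^-1 <= e * (c + t') by rewrite -ti ler_pM2r; lra.
have hti : t^-1 = c - e * t' * (B - e') by lra.
(* 1/t is eliminated, in a form where the coefficient B + 1 - e of c is
   positive *)
have h2 : c * (B + 1 - e) <= e * t' * ((B + 1) * (B - e') + 1).
  rewrite hti in h1; nra.
have h3 : (B + 1) * (B + 1 - e) <= e * t' * ((B + 1) * (B - e') + 1).
  apply: le_trans h2; rewrite ler_pM2r //; lra.
have P0 : 0 <= (B + 1) * (B - e') by rewrite mulr_ge0; lra.
have h4 : (B + 1) * (B + 1 - e) <= e * ((B + 1) * (B - e') + 1).
  apply: le_trans h3 _; rewrite ler_pM2r ?ler_piMr //; lra.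
have Q0 : 0 <= (B + 1) * (B + 1 - e') by rewrite mulr_ge0; lra.
(* h4 reads (B + 1)^2 <= e ((B + 1) (B + 1 - e') + 1), and e <= 1 *)
have h5 : e * ((B + 1) * (B + 1 - e') + 1) <= (B + 1) * (B + 1 - e') + 1.
  by rewrite ler_piMl //; lra.
have h6 : e' * 3 <= e' * (B + 1) by rewrite ler_pM2l //; lra.
lra.
Qed.

(** With e <= 1/2 the factor e^2 in quo_step is at most 1/4, and
    4 (b + y - 1) exceeds b + 1. *)
Lemma digb_step_jump (R : realType) (z : state R) :
  regular z -> rem (step z) != 0 -> gap z <= 1 / 2 ->
  digb z + 2 <= digb (step z).
Proof.
move=> rz tn0' e2; have [/andP[t0 t1] y1 U1] := rz.
have /andP[t0' t1'] := rem_step_gt0 tn0'.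
have hq := quo_step (lt0r_neq0 t0) tn0'; have /andP[e0 e1] := gap_itv z.
have b2 : 2 <= (digb z)%:~R :> R by exact/digb_ge2/ltW.
apply: le_digb; rewrite rmorphD /=.
have hw0 : 0 < rem z * rem (step z) by rewrite mulr_gt0.
have hw1 : rem z * rem (step z) < 1 by nra.
move: hq hw0 hw1; set w := rem z * _; set e := gap z in e0 e1 e2 *.
set b := (digb z)%:~R in b2 *; set U := quo _ => hq hw0 hw1.
have ew : 0 < e ^+ 2 * w by rewrite mulr_gt0 // exprn_gt0.
rewrite -(ler_pM2l ew) hq.
have e4 : e ^+ 2 <= 1 / 4 by nra.
have h : e ^+ 2 * w * (b + 2%:~R - 1) <= 1 / 4 * (b + 2%:~R - 1).
  by rewrite ler_pM2r; [nra|lra].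
have : e * (1 + w) <= 1 by nra.
have : 2%:~R = 2 :> R by [].
lra.
Qed.

(** * The first steps *)

(** Here igap = 0 and the estimates for regular states fail, but the integer
    part of 1/alpha is b - 1, hence e alpha (b - 1) <= 1; this makes the first
    digit c quadratic in b. *)
Lemma start_digc_ge (R : realType) (alpha : R) (z := start alpha) :
  0 < alpha <= 1 ->
  (digb z)%:~R * ((digb z)%:~R - 1) <= (digc z)%:~R :> R.
Proof.
move=> /andP[a0 a1]; have /andP[e0 e1] := gap_itv z.
have /andP[_ t1'] := rem_step_itv z.
have := step_c (z := z) (lt0r_neq0 a0); rewrite /= addr0 -/(rem (step z)).
have b2 : 2 <= (digb z)%:~R :> R by apply: digb_ge2; rewrite /= invf_ge1.
have : gap z = (digb z)%:~R - alpha^-1 by [].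
have ai : alpha * alpha^-1 = 1 by rewrite divff // gt_eqF.
have -> : (digb z)%:~R * ((digb z)%:~R - 1) = (digb z * (digb z - 1))%:~R :> R.
  by rewrite rmorphM rmorphB.
move=> he hc; apply: (intr_le_add t1'); rewrite rmorphM rmorphB /=.
move: hc; rewrite -[cquo z - _]/(rem (step z)).
set b := (digb z)%:~R in b2 he *; set e := gap z in e0 e1 he *.
set c := (digc z)%:~R; set t' := rem (step z) => hc.
have ea0 : 0 < e * alpha by rewrite mulr_gt0.
have ct0 : 0 < c + t' by rewrite -(pmulr_rgt0 _ ea0) hc; lra.
have h1 : alpha * (b - 1) <= 1 by rewrite -ai ler_pM2l //; lra.
have h2 : e * (alpha * (b - 1)) <= 1 by nra.
have -> : b * (b - 1) = e * (alpha * (b - 1)) * (c + t').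
  by rewrite -[X in X * (b - 1)]hc; ring.
by rewrite ler_piMl // ltW.
Qed.

Lemma start_quo_step_gt (R : realType) (alpha : R) (z := start alpha) :
  0 < alpha <= 1 -> rem (step z) != 0 -> (digb z)%:~R - 1 < quo (step z).
Proof.
move=> a01 tn0'; have cb := start_digc_ge a01.
have /andP[a0 a1] := a01; have /andP[e0 e1] := gap_itv z.
have /andP[t0' t1'] := rem_step_gt0 tn0'.
have hb := step_b tn0'; have he : gap z = (digb z)%:~R - alpha^-1 by [].
have b2 : 2 <= (digb z)%:~R :> R by apply: digb_ge2; rewrite /= invf_ge1.
have et0 : 0 < gap z * rem (step z) by rewrite mulr_gt0.
rewrite -(ltr_pM2l et0) hb -[(rem z)^-1]/(alpha^-1).
move: cb et0; rewrite -/z.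
set b := (digb z)%:~R in b2 he *; set e := gap z in e0 e1 he *.
set c := (digc z)%:~R; set t' := rem (step z) in t0' t1' * => cb et0.
have h1 : e * t' * (b - 1) < e * (b - 1) by rewrite ltr_pM2r ?gtr_pMr //; lra.
have h2 : e * (b - 2) <= b - 2 by rewrite ler_piMl //; lra.
have h3 : b - 2 <= b * (b - 2) by rewrite ler_peMl //; lra.
lra.
Qed.

Lemma regular_step_start (R : realType) (alpha : R) (z := start alpha) :
  0 < alpha <= 1 -> rem (step z) != 0 -> regular (step z).
Proof.
move=> a01 t0; split; [exact: rem_step_gt0|exact: igap_step|].
apply: le_lt_trans (start_quo_step_gt a01 t0).
have b2 : 2 <= (digb z)%:~R :> R.
  by case/andP: a01 => ? ?; apply: digb_ge2; rewrite /= invf_ge1.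
by rewrite -/z; lra.
Qed.

(** For b >= 3 the digit c >= b (b - 1) is at least 2 b, which sends the next U
    above b.  For b = 2 a repetition forces c = 2, and the step relations then
    determine everything from the remainder t of the next state. *)
Lemma start_repeat (R : realType) (alpha : R) (z := start alpha) :
  0 < alpha <= 1 -> rem (step z) != 0 -> digb (step z) = digb z ->
  [/\ digb z = 2, rem (step z) * (2 - gap (step z)) = 1
    & igap (step z) = 1 + rem (step z) / 4].
Proof.
move=> a01 tn0' bb; have cb := start_digc_ge a01.
have /andP[a0 a1] := a01; have /andP[e0 e1] := gap_itv z.
have /andP[e0' e1'] := gap_itv (step z).
have /andP[t0' t1'] := rem_step_gt0 tn0'.
have hb := step_b tn0'; have he : gap z = (digb z)%:~R - alpha^-1 by [].
have hc := step_c (z := z) (lt0r_neq0 a0).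
have b2 : 2 <= (digb z)%:~R :> R by apply: digb_ge2; rewrite /= invf_ge1.
have hU : quo (step z) = (digb z)%:~R - gap (step z) by rewrite /gap bb; ring.
rewrite hU -[(rem z)^-1]/(alpha^-1) in hb.
rewrite -[igap z]/(0 : R) -[rem z]/alpha addr0 in hc.
have igE : igap (step z) = (gap z)^-1 by [].
have et0 : 0 < gap z * rem (step z) by rewrite mulr_gt0.
have et1 : gap z * rem (step z) < gap z by rewrite gtr_pMr.
have ai : alpha * alpha^-1 = 1 by rewrite divff // gt_eqF.
rewrite -/z in cb; rewrite igE.
have b2E : digb z = 2.
  apply/eqP; rewrite -(eqr_int R) eq_le b2 andbT.
  rewrite (_ : 2%:~R = 2 :> R) // leNgt; apply/negP => b2'.
  have b3 : 3 <= (digb z)%:~R :> R.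
    have : 2 < digb z by rewrite -(ltr_int R).
    by rewrite -lez1D -(ler_int R).
  move: cb hb; set b := (digb z)%:~R in b2 b3 he *.
  set e' := gap (step z) in e0' e1' *; set c := (digc z)%:~R => cb hb.
  have h1 : gap z * rem (step z) * (b - e') <= b - e'.
    by rewrite ler_piMl //; lra.
  have h3 : b <= b * (b - 2) by rewrite ler_peMr //; lra.
  lra.
rewrite b2E (_ : 2%:~R = 2 :> R) // in he hb hc cb *.
set t' := rem (step z) in t0' t1' et0 et1 hb hc *.
set e' := gap (step z) in e0' e1' hb *.
set e := gap z in e0 e1 he et0 et1 hb hc *.
have h1 : e * t' * (2 - e') < e * (1 + 1).
  apply: (@le_lt_trans _ _ (e * t' * 2)); last by lra.
  by rewrite ler_pM2l //; lra.
have c2 : (digc z)%:~R = 2 :> R.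
  apply/eqP; rewrite eq_le; apply/andP; split; last by lra.
  apply: (@intr_le_add _ _ 2 (e * t' * (2 - e') - e)); first by lra.
  by rewrite (_ : 2%:~R = 2 :> R) //; lra.
rewrite c2 in hb hc.
have h2 : t' * (2 - e') = 1.
  by apply: (mulfI (lt0r_neq0 e0)); rewrite mulrA hb; lra.
split => //.
have h3 : e * (2 + t') = 2 * (2 - e).
  apply: (mulfI (lt0r_neq0 a0)).
  have -> : alpha * (e * (2 + t')) = 2 by lra.
  by rewrite he; lra.
by apply: (mulfI (lt0r_neq0 e0)); rewrite divff ?gt_eqF //; lra.
Qed.

Lemma start_repeat_digc (R : realType) (alpha : R) (z := step (start alpha)) :
  0 < alpha <= 1 -> rem z != 0 -> digb z = digb (start alpha) ->
  3 <= (digc z)%:~R :> R.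
Proof.
move=> a01 tn0 bb; have [b2 _ hy] := start_repeat a01 tn0 bb.
have /andP[t0 t1] := rem_step_gt0 tn0.
have /andP[e0 e1] := gap_itv z.
have hc := step_c tn0; have /andP[t0' t1'] := rem_step_itv z.
rewrite -/z bb b2 hy in hc.
rewrite -[3]/(3%:~R); apply: (intr_le_add t1').
have et0 : 0 < gap z * rem z by rewrite mulr_gt0.
have et1 : gap z * rem z <= 1 by rewrite mulr_ile1 // ltW.
have h0 : gap z * rem z * ((digc z)%:~R + rem (step z)) = 3 + rem z / 4.
  by rewrite hc (_ : 2%:~R = 2 :> R) // -/z; lra.
have c0 : 0 < (digc z)%:~R + rem (step z).
  by rewrite -(pmulr_rgt0 _ et0) h0 -/z; lra.
apply: (@le_trans _ _ (3 + rem z / 4)); first by rewrite lerDl divr_ge0 // ltW.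
by rewrite -h0 ler_piMl // ltW.
Qed.

Lemma start_repeat_digb (R : realType) (alpha : R) (z := step (start alpha)) :
  0 < alpha <= 1 -> rem z != 0 -> digb z = digb (start alpha) ->
  rem (step z) != 0 -> 3 <= digb (step z).
Proof.
move=> a01 tn0 bb tn0'; have [_ ht _] := start_repeat a01 tn0 bb.
have c3 := start_repeat_digc a01 tn0 bb; rewrite -/z in ht c3.
have /andP[t0' t1'] := rem_step_gt0 tn0'; have /andP[e0 e1] := gap_itv z.
have hb := step_b tn0'.
have it : (rem z)^-1 = 2 - gap z.
  by apply: (mulfI tn0); rewrite divff // ht.
have et0 : 0 < gap z * rem (step z) by rewrite mulr_gt0.
apply: le_digb; rewrite (_ : 3%:~R - 1 = 2 :> R); last first.
  by rewrite -[3%:~R]/(3 : R); lra.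
rewrite -(ler_pM2l et0) hb it.
have : gap z * rem (step z) <= gap z by rewrite ler_piMr // ltW.
lra.
Qed.

(** With b_1 = b_2 = 2 and x the overshoot of b_2, the digit b_3 = 3 forces
    c_2 = 3.  Then x t_2 = 25/4 - 6 x, and the step relations express U_3
    through x and c_3.  The condition t_2 < 1 forces c_3 >= 4, and t_3 < 1
    bounds x from above when c_3 = 4; U_3 stays above 7/2 on the
    resulting interval. *)
Lemma start_repeat_quo (R : realType) (alpha : R) (z := step (start alpha)) :
  0 < alpha <= 1 -> rem z != 0 -> digb z = digb (start alpha) ->
  rem (step z) != 0 -> digb (step z) = 3 ->
  rem (step (step z)) != 0 -> 7 / 2 <= quo (step (step z)).
Proof.
move=> a01 tn0 bb tn0' b3 tn0''; have [b2 ht hy] := start_repeat a01 tn0 bb.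
have c3 := start_repeat_digc a01 tn0 bb; rewrite -/z in ht hy c3.
have /andP[t0' t1'] := rem_step_gt0 tn0'; have /andP[e0 e1] := gap_itv z.
have /andP[t0'' t1''] := rem_step_gt0 tn0''.
have /andP[e0' e1'] := gap_itv (step z).
have hb := step_b tn0'; have hb' := step_b tn0''.
have hc := step_c tn0; have hc' := step_c tn0'.
have it : (rem z)^-1 = 2 - gap z.
  by apply: (mulfI tn0); rewrite divff // ht.
have hU : quo (step z) = 3 - gap (step z).
  by rewrite /gap b3 (_ : 3%:~R = 3 :> R) //; ring.
rewrite hU it in hb; rewrite bb b2 hy (_ : 2%:~R = 2 :> R) // in hc.
rewrite b3 (_ : 3%:~R = 3 :> R) // [igap _]/= in hc'.
have xi : gap z * (gap z)^-1 = 1 by rewrite divff // gt_eqF.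
have ti' : rem (step z) * (rem (step z))^-1 = 1 by rewrite divff.
move: (gap z) (rem z) (gap (step z)) (rem (step z)) (quo (step (step z)))
  (rem (step (step z))) (gap z)^-1 (rem (step z))^-1 ht hy it c3 t0' t1' e0 e1
  t0'' t1'' e0' e1' hb hb' hc hc' xi ti'
  => x t1 e3 t2 U3 t3 xi ti ht hy it c3 t20 t21 x0 x1 t30 t31 e30 e31.
move=> hb hb' hc hc' hxi hti.
have xt2 : 0 < x * t2 by rewrite mulr_gt0.
have xt2x : x * t2 < x by rewrite gtr_pMr.
have h0 : x * t2 * (3 - e3) < x * 3.
  apply: (@lt_le_trans _ _ (x * t2 * 3)); last by rewrite ler_pM2r //; lra.
  by rewrite ltr_pM2l //; lra.
have c23 : (digc z)%:~R = 3 :> R.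
  apply/eqP; rewrite eq_le c3 andbT -[3]/(3%:~R).
  apply: (@intr_le_add _ _ _ (x * t2 * (3 - e3) - x - 1)); first by lra.
  by rewrite (_ : 3%:~R = 3 :> R) //; lra.
rewrite c23 in hb hc.
(* the relation hc multiplied by 2 - x, so that ht removes t1 *)
have hD : x * t2 = 25 / 4 - 6 * x.
  have : (2 - x) * (x * t1 * (3 + t2)) = (2 - x) * (2 + (1 + t1 / 4)).
    by rewrite hc.
  have -> : (2 - x) * (x * t1 * (3 + t2)) = x * (3 + t2) * (t1 * (2 - x)).
    by ring.
  have -> : (2 - x) * (2 + (1 + t1 / 4)) = 3 * (2 - x) + t1 * (2 - x) / 4.
    by field.
  by rewrite ht; lra.
have hA : x * t2 * e3 = 71 / 4 - 19 * x by lra.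
have A0 : 0 < x * t2 * e3 by rewrite mulr_gt0.
have hc3 : x * t2 * e3 * ((digc (step z))%:~R + t3) = 3 * x + 1.
  have -> : 3 * x + 1 = x * (3 + xi) by rewrite mulrDr hxi; ring.
  by rewrite -hc'; ring.
have hU3 : x * t2 * e3 * t3 * U3 = (digc (step z))%:~R * (x * t2) - x.
  have -> : x * t2 * e3 * t3 * U3 = x * t2 * (e3 * t3 * U3) by ring.
  by rewrite hb' mulrBr -[x * t2 * ti]mulrA hti; ring.
move: hc3 hU3 A0; rewrite hA hD => hc3 hU3 A0.
have c4 : 4 <= (digc (step z))%:~R :> R.
  rewrite -[4]/(4%:~R); apply: (intr_le_add t31).
  rewrite -(ler_pM2l A0) hc3 (_ : 4%:~R = 4 :> R) //; lra.
have At3 : (71 / 4 - 19 * x) * t3 < 71 / 4 - 19 * x by rewrite gtr_pMr.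
have At30 : 0 < (71 / 4 - 19 * x) * t3 by rewrite mulr_gt0.
rewrite -(ler_pM2l At30) hU3.
have [c4'|c5] := ltP ((digc (step z))%:~R : R) 5.
  have c4E : (digc (step z))%:~R = 4 :> R.
    apply/eqP; rewrite eq_le c4 andbT -[4]/(4%:~R) ler_int -ltzD1.
    by rewrite -(ltr_int R).
  by rewrite c4E in hc3 *; lra.
have h5 : (71 / 4 - 19 * x) * 5 <= (71 / 4 - 19 * x) * (digc (step z))%:~R.
  by rewrite ler_pM2l.
have h6 : 5 * (25 / 4 - 6 * x) <= (digc (step z))%:~R * (25 / 4 - 6 * x).
  by rewrite ler_pM2r //; lra.
lra.
Qed.

(** * Growth along an orbit *)

(** The invariant behind b_n >= n: one unit above m, or level with m while the
    small overshoot guarantees that the next digit grows by 2. *)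
Definition ahead (R : realType) (z : state R) (m : int) : Prop :=
  m + 1 <= digb z \/ m <= digb z /\ gap z <= 1 / 2.

Lemma ahead_le (R : realType) (z : state R) (m : int) :
  ahead z m -> m <= digb z.
Proof. by case=> [|[]//]; lia. Qed.

Lemma ahead_step (R : realType) (z : state R) (m : int) :
  regular z -> rem (step z) != 0 -> ahead z m -> ahead (step z) (m + 1).
Proof.
move=> rz t0 [h|[h e2]]; last first.
  by left; have := digb_step_jump rz t0 e2; lia.
have := digb_step rz t0; rewrite le_eqVlt => /orP[/eqP bb|lt_b].
  by right; split; [lia|exact: gap_step_repeat].
by left; lia.
Qed.

Definition orbit (R : realType) (alpha : R) (n : nat) : state R :=
  iter n (@step R) (start alpha).

(** The remainder vanishes exactly when alpha = [0; b_1, ..., b_k] +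
    [0; c_1, ..., c_k], that is when the algorithm stops at step k. *)
Definition alive (R : realType) (alpha : R) (n : nat) : Prop :=
  forall k, (k <= n)%N -> rem (orbit alpha k) != 0.

Lemma alive_le (R : realType) (alpha : R) (m n : nat) :
  (m <= n)%N -> alive alpha n -> alive alpha m.
Proof. by move=> mn a k km; apply: a; apply: leq_trans mn. Qed.

Lemma regular_orbit (R : realType) (alpha : R) (n : nat) :
  0 < alpha <= 1 -> alive alpha n.+1 -> regular (orbit alpha n.+1).
Proof.
move=> a01; elim: n => [|n IH] al.
  by apply: regular_step_start => //; exact: (al 1%N).
by apply: regular_step; [exact/IH/(alive_le _ al)|exact: (al n.+2)].
Qed.

Lemma orbit_digb_le (R : realType) (alpha : R) (n : nat) :
  0 < alpha <= 1 -> alive alpha n.+1 ->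
  digb (orbit alpha n) <= digb (orbit alpha n.+1).
Proof.
move=> a01 al; have tn0 := al n.+1 (leqnn _); case: n al tn0 => [|n] al tn0.
  exact/le_digb/ltW/start_quo_step_gt.
by apply: digb_step tn0; exact/regular_orbit/(alive_le _ al).
Qed.

(** A repetition leaves an overshoot at most 1/2, hence a jump; a repetition at
    the first step is only possible as 2, 2, followed by at least 3. *)
Lemma orbit_digb_lt2 (R : realType) (alpha : R) (n : nat) :
  0 < alpha <= 1 -> alive alpha n.+2 ->
  digb (orbit alpha n) + 1 <= digb (orbit alpha n.+2).
Proof.
move=> a01 al; have al1 := alive_le (leqnSn _) al.
have h1 := orbit_digb_le a01 al1; have h2 := orbit_digb_le a01 al.
move: h1; rewrite le_eqVlt => /orP[/eqP bb|]; last by lia.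
have tn0 := al n.+1 (leqnSn _); have tn0' := al n.+2 (leqnn _).
case: n al al1 h2 bb tn0 tn0' => [|n] al al1 h2 bb tn0 tn0'.
  have [b2 _ _] := start_repeat a01 tn0 (esym bb).
  rewrite (b2 : digb (orbit alpha 0) = 2).
  exact: start_repeat_digb a01 tn0 (esym bb) tn0'.
have e2 := gap_step_repeat (regular_orbit a01 (alive_le (leqnSn _) al1)) tn0
  (esym bb).
rewrite bb; apply: le_trans (digb_step_jump (regular_orbit a01 al1) tn0' e2).
by rewrite lerD2l.
Qed.

(** The orbit state with index n carries b_(n+1).  The invariant starts with
    b_4 because it can fail for b_2 and b_3 if the digits begin with 2, 2, 3. *)
Lemma ahead_orbit (R : realType) (alpha : R) (n : nat) :
  0 < alpha <= 1 -> alive alpha n.+3 -> ahead (orbit alpha n.+3) n.+4%:Z.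
Proof.
move=> a01; elim: n => [|n IH] al; last first.
  have al' := alive_le (leqnSn _) al; rewrite intS addrC.
  apply: ahead_step (IH al'); last exact: (al n.+4).
  exact: regular_orbit.
have [t1 t2 t3] : [/\ rem (orbit alpha 1) != 0, rem (orbit alpha 2) != 0
  & rem (orbit alpha 3) != 0] by split; apply: al.
have al2 : alive alpha 2 by apply: alive_le al.
have al1 : alive alpha 1 by apply: alive_le al.
have r1 := regular_orbit a01 al1; have r2 := regular_orbit a01 al2.
have b0 : 2 <= digb (start alpha).
  case/andP: a01 => a0 a1; rewrite -(ler_int R).
  by apply: digb_ge2; rewrite /= invf_ge1.
have := orbit_digb_le a01 al1; rewrite le_eqVlt => /orP[/eqP bb|lt_b].
  have h3 := start_repeat_digb a01 t1 (esym bb) t2.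
  have [b3|b3] := eqVneq (digb (orbit alpha 2)) 3; last first.
    apply: (ahead_step (m := 3) r2 t3); left.
    by move: h3 b3; rewrite -[step _]/(orbit alpha 2); lia.
  have U := start_repeat_quo a01 t1 (esym bb) t2 b3 t3.
  rewrite /ahead -[orbit alpha 3]/(step (step (step (start alpha)))).
  set z := step (step _) in U *.
  have b4 : 4 <= digb z by apply: le_digb; rewrite -[4%:~R]/(4 : R); lra.
  have [b5|b5] := leP 5 (digb z); [left; lia|right; split => //].
  have -> : gap z = 4 - quo z by rewrite /gap (_ : digb z = 4) //; lia.
  by lra.
apply: (ahead_step (m := 3) r2 t3); apply: (ahead_step (m := 2) r1 t2); left.
by move: lt_b b0; rewrite -[orbit alpha 0]/(start alpha); lia.
Qed.

Lemma orbit_digb_ge (R : realType) (alpha : R) (n : nat) :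
  0 < alpha <= 1 -> alive alpha n -> n.+1%:Z <= digb (orbit alpha n).
Proof.
move=> a01; have b0 : 2 <= digb (orbit alpha 0).
  case/andP: a01 => a0 a1; rewrite -(ler_int R).
  by apply: digb_ge2; rewrite /= invf_ge1.
case: n => [|[|[|n]]] al.
- by move: b0; lia.
- by have := orbit_digb_le a01 al; lia.
- by have := orbit_digb_lt2 a01 al; lia.
- exact/ahead_le/ahead_orbit.
Qed.

Lemma cquo_ge2 (R : realType) (z : state R) :
  0 < rem z <= 1 -> 0 <= igap z -> 1 <= quo z -> 2 <= cquo z.
Proof.
move=> /andP[t0 t1] y0 U1; have /andP[e0 e1] := gap_itv z.
have b2 := digb_ge2 U1.
have et0 : 0 < gap z * rem z by rewrite mulr_gt0.
have et1 : gap z * rem z <= 1 by rewrite mulr_ile1 // ltW.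
by rewrite /cquo ler_pdivlMr //; lra.
Qed.

Lemma orbit_bounds (R : realType) (alpha : R) (n : nat) :
  0 < alpha <= 1 -> alive alpha n -> [/\ 0 < rem (orbit alpha n) <= 1,
    0 <= igap (orbit alpha n), 1 <= quo (orbit alpha n)
    & n = 0 \/ 1 < quo (orbit alpha n)].
Proof.
move=> a01; case: n => [|n] al.
  have /andP[a0 a1] := a01; split => //=; last by left.
  by rewrite invf_ge1.
have [/andP[t0 t1] y1 U1] := regular_orbit a01 al.
by split; [rewrite t0 ltW|exact: le_trans y1|exact: ltW|right].
Qed.

(** * The algorithm follows the orbit *)

(** q, q' and s, s' are the denominators of the last two convergents of
    [0; b_1, ..., b_n] and [0; c_1, ..., c_n].  The second equation says that
    [0; b_1, ..., b_n + 1/U] - [0; b_1, ..., b_n] and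
    [0; c_1, ..., c_n + t] - [0; c_1, ..., c_n] agree.  The first one expresses
    igap through the denominators and closes the recursion: without it
    the next state would depend on q, q', s, s'. *)
Definition balanced (R : realType) (q q' s s' : R) (z : state R) : Prop :=
  (s + rem z * s') * s' = q * (q * igap z - q') /\
  (rem z != 0 -> (s + rem z * s') * s = rem z * q * (q * quo z + q')).

Section Balance.
Variables (R : realType) (q q' s s' : R) (z : state R).
Hypotheses (bal : balanced q q' s s' z) (q0 : 0 < q) (s0 : 0 < s)
  (t0 : 0 < rem z).

(** The sum of the two equations, weighted by 1 and t, gives
    (s + t s')^2 = t q^2 (U + y); the second equation squared removes
    s + t s'. *)
Lemma balanced_sqr :
  (quo z + igap z) * s ^+ 2 = rem z * (q * quo z + q') ^+ 2.
Proof.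
have [R1 R2] := bal; move: {R2}(R2 (lt0r_neq0 t0)) R1.
move: (rem z) (quo z) (igap z) t0 => t U y t0' R2 R1.
have tq0 : t * q ^+ 2 != 0 by rewrite mulf_neq0 ?expf_neq0 ?gt_eqF.
apply: (mulfI tq0).
have P2 : (s + t * s') ^+ 2 = t * q ^+ 2 * (U + y).
  have -> : (s + t * s') ^+ 2 = (s + t * s') * s + t * ((s + t * s') * s').
    by ring.
  by rewrite R1 R2; ring.
rewrite mulrA -P2 -exprMn R2; ring.
Qed.

(** The same equality of differences as in balanced, for the new digit b: it
    identifies cquo as the complete quotient of
    alpha - [0; b_1, ..., b_n, b]. *)
Lemma balanced_cquo :
  (s * cquo z + s') * s * gap z =
  (q * quo z + q') * (q * (digb z)%:~R + q').
Proof.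
have [_ R2] := bal; have K1 := balanced_sqr; have /andP[e0 _] := gap_itv z.
have R2' := R2 (lt0r_neq0 t0).
have -> : q * (digb z)%:~R + q' = (q * quo z + q') + gap z * q.
  by rewrite /gap; ring.
apply: (mulfI (lt0r_neq0 t0)).
have -> : rem z * ((s * cquo z + s') * s * gap z) =
    (quo z + igap z) * s ^+ 2 + gap z * ((s + rem z * s') * s).
  have -> : cquo z = (quo z + gap z + igap z) / (gap z * rem z).
    by rewrite /cquo /gap; congr (_ / _); ring.
  by field; rewrite !gt_eqF.
by rewrite K1 R2'; ring.
Qed.

Lemma balanced_step :
  balanced (q * (digb z)%:~R + q') q (s * (digc z)%:~R + s') s (step z).
Proof.
have K1 := balanced_sqr; have K2 := balanced_cquo.
have /andP[e0 _] := gap_itv z; have en0 := lt0r_neq0 e0.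
have tn0 := lt0r_neq0 t0; have sn0 := lt0r_neq0 s0.
have qb : q * (digb z)%:~R + q' = (q * quo z + q') + gap z * q.
  by rewrite /gap; ring.
have K3 : cquo z - (rem z)^-1 = (quo z + igap z) / (gap z * rem z).
  have -> : cquo z = (quo z + gap z + igap z) / (gap z * rem z).
    by rewrite /cquo /gap; congr (_ / _); ring.
  by field; rewrite !gt_eqF.
rewrite /balanced -[igap (step z)]/((gap z)^-1).
have remE : rem (step z) = cquo z - (digc z)%:~R by [].
have -> : s * (digc z)%:~R + s' + rem (step z) * s = s * cquo z + s'.
  by rewrite remE; ring.
split=> [|tn0'].
  apply: (mulIf en0); rewrite K2 qb; field; exact: en0.
have hb := step_b tn0'.
apply: (mulIf en0).
have -> : rem (step z) * (q * (digb z)%:~R + q') *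
  ((q * (digb z)%:~R + q') * quo (step z) + q) * gap z =
  (q * (digb z)%:~R + q') *
    ((q * (digb z)%:~R + q') * (gap z * rem (step z) * quo (step z))
      + gap z * rem (step z) * q) by ring.
rewrite hb.
have -> : s * (digc z)%:~R + s' = s * cquo z + s' - rem (step z) * s.
  by rewrite remE; ring.
(* multiplied by gap z * s ^+ 2, this is the square of balanced_cquo *)
have K4 : gap z * (s * cquo z + s') ^+ 2 =
    (q * (digb z)%:~R + q') ^+ 2 * (cquo z - (rem z)^-1).
  have ess : gap z * s ^+ 2 != 0 by rewrite mulf_neq0 ?expf_neq0.
  apply: (mulfI ess).
  have -> : gap z * s ^+ 2 * (gap z * (s * cquo z + s') ^+ 2) =
    ((s * cquo z + s') * s * gap z) ^+ 2 by ring.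
  rewrite K2 K3 exprMn.
  have -> : gap z * s ^+ 2 * ((q * (digb z)%:~R + q') ^+ 2 *
      ((quo z + igap z) / (gap z * rem z))) =
    (quo z + igap z) * s ^+ 2 * (q * (digb z)%:~R + q') ^+ 2 / rem z.
    by field; rewrite tn0.
  by rewrite K1; field.
have -> : (s * cquo z + s') * (s * cquo z + s' - rem (step z) * s) * gap z =
  gap z * (s * cquo z + s') ^+ 2
    - rem (step z) * ((s * cquo z + s') * s * gap z) by ring.
rewrite K4 K2 remE [in RHS]/gap; ring.
Qed.

End Balance.

Definition tracks (R : realType) (alpha : R) (bs cs : seq int) (z : state R) :=
  [/\ positive bs, positive cs, size bs = size cs,
      alpha = cfrac R bs + cftail cs (rem z)
    & balanced (conts R bs).1 (conts R bs).2 (conts R cs).1 (conts R cs).2 z].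

Lemma tracks_start (R : realType) (alpha : R) :
  tracks alpha [::] [::] (start alpha).
Proof.
split => //=; first by rewrite add0r.
split=> /=; first by rewrite !mulr0 subrr mulr0.
by move=> a0; rewrite mulr0 !addr0 !mul1r mulr1 divff.
Qed.

Section Tracking.
Variables (R : realType) (alpha : R) (bs cs : seq int) (z : state R).
Hypotheses (tr : tracks alpha bs cs z) (t0 : 0 < rem z) (U0 : 0 < quo z).

Lemma tracks_quo : alpha - cfrac R cs = cftail bs (quo z)^-1.
Proof.
have [pb pc sz aE [_ /(_ (lt0r_neq0 t0)) R2]] := tr.
have [q0 q0'] := conts_gt0 R pb; have [s0 s0'] := conts_gt0 R pc.
suff : cftail cs (rem z) - cftail cs 0 = cftail bs (quo z)^-1 - cftail bs 0.
  by rewrite aE !cfrac_cftail; lra.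
rewrite !cftail_sub ?invr_ge0 ?(ltW U0) ?(ltW t0) // sz -!mulrA; congr (_ * _).
move: R2 q0 q0' s0 s0'.
set q := (conts R bs).1; set q' := (conts R bs).2.
set s := (conts R cs).1; set s' := (conts R cs).2 => R2 q0 q0' s0 s0'.
rewrite !mul0r !addr0 !subr0 R2.
have d0 : 0 < q * quo z + q' by rewrite ltr_wpDr // mulr_gt0.
field; rewrite !gt_eqF //.
Qed.

Lemma tracks_cquo : 0 < cquo z ->
  alpha - cfrac R (rcons bs (digb z)) = cftail cs (cquo z)^-1.
Proof.
move=> T0; have [pb pc sz aE bal] := tr.
have [q0 q0'] := conts_gt0 R pb; have [s0 s0'] := conts_gt0 R pc.
have /andP[e0 _] := gap_itv z; have K2 := balanced_cquo bal q0 t0.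
have b0 : 0 < (digb z)%:~R :> R.
  by move: e0; rewrite /gap subr_gt0; exact: lt_trans.
suff : cftail bs (quo z)^-1 - cftail bs (digb z)%:~R^-1
    = cftail cs (cquo z)^-1 - cftail cs 0.
  by rewrite -tracks_quo !cfrac_cftail cftail_rcons addr0; lra.
rewrite !cftail_sub ?invr_ge0 ?(ltW U0) ?(ltW b0) ?(ltW T0) //.
rewrite sz -!mulrA; congr (_ * _).
move: K2 q0 q0' s0 s0'.
set q := (conts R bs).1; set q' := (conts R bs).2.
set s := (conts R cs).1; set s' := (conts R cs).2 => K2 q0 q0' s0 s0'.
rewrite !mul0r !addr0 !subr0.
have d0 : 0 < q * quo z + q' by rewrite ltr_wpDr // mulr_gt0.
have d1 : 0 < q * (digb z)%:~R + q' by rewrite ltr_wpDr // mulr_gt0.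
have d2 : 0 < s * cquo z + s' by rewrite ltr_wpDr // mulr_gt0.
have -> : (quo z)^-1 - (digb z)%:~R^-1 = gap z / (quo z * (digb z)%:~R).
  by rewrite /gap; field; rewrite !gt_eqF.
transitivity (gap z / ((q * quo z + q') * (q * (digb z)%:~R + q'))).
  by field; rewrite !gt_eqF.
rewrite -K2; field; rewrite !gt_eqF //.
Qed.

Lemma tracks_step : 1 <= cquo z ->
  tracks alpha (rcons bs (digb z)) (rcons cs (digc z)) (step z).
Proof.
move=> T1; have [pb pc sz aE bal] := tr.
have T0 : 0 < cquo z by lra.
have [q0 q0'] := conts_gt0 R pb; have [s0 s0'] := conts_gt0 R pc.
split; rewrite ?all_rcons ?pb ?pc ?size_rcons ?sz //.
- rewrite andbT -(ltr_int R); apply: lt_trans U0 _.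
  by have /andP[] := gap_itv z; rewrite subr_gt0.
- by rewrite andbT /digc floor_gt0.
- rewrite cftail_rcons [rem (step z)]/= subrKC -tracks_cquo //.
  by rewrite subrKC.
- by rewrite !conts_rcons; exact: balanced_step.
Qed.

End Tracking.

Lemma next_b_digb (R : realType) (alpha : R) (n : nat) (bs cs : seq int)
    (b : int) :
  0 <= alpha <= 1 -> (forall k, (k < n)%N -> rem (orbit alpha k) != 0) ->
  tracks alpha bs cs (orbit alpha n) -> size bs = n ->
  next_b alpha bs cs = Some b ->
  [/\ 0 < alpha, alive alpha n & b = digb (orbit alpha n)].
Proof.
move=> /andP[a0 a1] al tr sz; rewrite /next_b.
have [pb pc _ aE _] := tr.
case: ifPn => // stop; case E : partial_quotient => [a|//] [<-].
have tn0 : rem (orbit alpha n) != 0.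
  by apply: contraNneq stop => t0; rewrite {1}aE t0 -cfrac_cftail.
have al' : alive alpha n.
  by move=> k; rewrite leq_eqVlt => /orP[/eqP ->|/al].
have {}a0 : 0 < alpha by rewrite lt_neqAle eq_sym a0 andbT (al' 0%N).
have a01 : 0 < alpha <= 1 by rewrite a0.
split => //; have [/andP[t0 t1] _ U1 nU] := orbit_bounds a01 al'.
have U0 : 0 < quo (orbit alpha n) by lra.
rewrite /digb; congr (_ + _); rewrite -[quo _]invrK.
apply: (partial_quotient_cftail pb); last by rewrite -(tracks_quo tr t0 U0).
  by rewrite invr_gt0 U0 invf_le1.
case: nU => [n0|U1']; last by right; rewrite invf_lt1.
by left; apply: size0nil; rewrite sz.
Qed.

(** The digits of the algorithm agree with those of the orbit by induction: the
    bounds U > 1 (U >= 1 at the start) and cquo > 1, which hold until the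
    algorithm stops, make 1/U and 1/cquo the tails that the Gauss map finds. *)
Lemma shulga_tracks (R : realType) (alpha : R) (n : nat) (bs cs : seq int) :
  0 <= alpha <= 1 -> shulga_prefix alpha n = Some (bs, cs) ->
  [/\ forall k, (k < n)%N -> rem (orbit alpha k) != 0,
      tracks alpha bs cs (orbit alpha n) & size bs = n].
Proof.
move=> a01; elim: n bs cs => [|n IH] bs cs /=.
  by case=> <- <-; split => //; exact: tracks_start.
case: shulga_prefix IH => [[bs' cs']|//] /(_ _ _ erefl) [al tr sz] /=.
case Eb : next_b => [b|//] /=; case Ec : next_c => [c|//] /= [<- <-].
have [a0 al' bE] := next_b_digb a01 al tr sz Eb.
have a01' : 0 < alpha <= 1 by case/andP: a01 => _ ->; rewrite a0.
have [t01 y0 U1 _] := orbit_bounds a01' al'.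
have T2 := cquo_ge2 t01 y0 U1; have /andP[t0 t1] := t01.
have U0 : 0 < quo (orbit alpha n) by lra.
have T0 : 0 < cquo (orbit alpha n) by lra.
have [pb pc szc _ _] := tr.
have cE : c = digc (orbit alpha n).
  rewrite /digc -[cquo _]invrK; apply: (partial_quotient_cftail pc).
  - by rewrite invr_gt0 T0 invf_le1 //; lra.
  - by right; rewrite invf_lt1 //; lra.
  - by rewrite -(tracks_cquo tr t0 U0 T0) -szc -bE.
rewrite bE cE size_rcons sz; split => //.
by apply: tracks_step => //; lra.
Qed.

Lemma shulga_b_orbit (R : realType) (alpha : R) (n : nat) (b : int) :
  0 <= alpha <= 1 -> shulga_b alpha n.+1 = Some b ->
  [/\ 0 < alpha <= 1, alive alpha n & b = digb (orbit alpha n)].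
Proof.
move=> a01 /=; case E : shulga_prefix => [[bs cs]|//] /= hb.
have [al tr sz] := shulga_tracks a01 E.
have [a0 al' bE] := next_b_digb a01 al tr sz hb.
by split => //; case/andP: a01 => _ ->; rewrite a0.
Qed.

Theorem theorem6 (R : realType) (alpha : R) (halpha : 0 <= alpha <= 1)
    (n : nat) (hn : (1 <= n)%N) :
  [/\ forall u v : int, shulga_b alpha n = Some u ->
        shulga_b alpha n.+1 = Some v -> u <= v,
      forall u w : int, shulga_b alpha n = Some u ->
        shulga_b alpha n.+2 = Some w -> u + 1 <= w
    & forall u : int, shulga_b alpha n = Some u -> n%:Z <= u].
Proof.
case: n hn => // n _; split=> [u v|u w|u] /(shulga_b_orbit halpha)[a01 al ->].
- by move=> /(shulga_b_orbit halpha)[_ al' ->]; exact: orbit_digb_le.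
- by move=> /(shulga_b_orbit halpha)[_ al' ->]; exact: orbit_digb_lt2.
- exact: orbit_digb_ge.
Qed.
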